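(* Define operators $(A_j)_{j\ge1}$ on $\mathcal P=\mathbb Q(b)[p_1,p_2,\dots]$ by $A_{j+1}f:=\Theta_YY_+\Lambda_Y^j\big(\frac{y_0}{1+b}f\big)$ for $j\ge0$ and $f\in\mathcal P$. Then $A_1$ is multiplication by $p_1/(1+b)$ and $A_{j+1}=[D_\alpha,A_j]$ for all $j\ge1$, as operators on $\mathcal P$.
   Context: Variables $b$, $\alpha=1+b$, $\mathbf p=(p_i)_{i\ge1}$, $\bm y=(y_i)_{i\ge0}$. Operators on polynomials in $\mathbf p,\bm y$: $\Theta_Y=\sum_{i\ge1}p_i\frac{\partial}{\partial y_i}$; $Y_+=\sum_{i\ge0}y_{i+1}\frac{\partial}{\partial y_i}$; $\Lambda_Y=(1+b)\sum_{i,j\ge1}iy_{i+j-1}\frac{\partial^2}{\partial p_i\partial y_{j-1}}+\sum_{i,j\ge1}y_{i-1}p_j\frac{\partial}{\partial y_{i+j-1}}+b\sum_{i\ge0}iy_i\frac{\partial}{\partial y_i}$. The Laplace–Beltrami operator is $D_\alpha=\frac12\Big((1+b)\sum_{i,j\ge1}ijp_{i+j}\frac{\partial^2}{\partial p_i\partial p_j}+\sum_{i,j\ge1}(i+j)p_ip_j\frac{\partial}{\partial p_{i+j}}+b\sum_{i\ge1}i(i-1)p_i\frac{\partial}{\partial p_i}\Big)$. $[A,B]=AB-BA$. *)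

(* Defs.v *)
From HB Require Import structures.
From mathcomp Require Import all_boot all_order all_algebra.
From mathcomp Require Import finmap.
From mathcomp.multinomials Require Import monalg.

Set Implicit Arguments.
Unset Strict Implicit.
Unset Printing Implicit Defensive.

Import Order.TTheory GRing.Theory Num.Theory.
Local Open Scope ring_scope.

Definition Qb : fieldType := {fraction {poly rat}}.
Definition bb : Qb := tofrac ('X : {poly rat}).

(* Variables: [inl i] stands for p_i (only i >= 1 is used),
   [inr i] stands for y_i (i >= 0). *)
Definition var : choiceType := (nat + nat)%type.

Definition Pol := {malg Qb[cmonom var]}.

Definition cst (c : Qb) : Pol := c%:MP.
Definition pv (i : nat) : Pol := << @ucm var (inl i) >>.
Definition yv (i : nat) : Pol := << @ucm var (inr i) >>.

Definition inP (f : Pol) : Prop :=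
  forall m : cmonom var, m \in msupp f ->
  forall v : var, v \in finsupp m -> exists2 i : nat, (0 < i)%N & v = inl i.

Definition term (g : Pol) (m : cmonom var) : Pol := << g@_m *g m >>.

Definition deriv (v : var) (g : Pol) : Pol :=
  \sum_(m <- msupp g) << (g@_m *+ (m v)) *g divcm m (@ucm var v) >>.

(* First-order operator  sum_v c v * d/dv  (finite on every polynomial). *)
Definition ord1 (c : var -> Pol) (g : Pol) : Pol :=
  \sum_(m <- msupp g) \sum_(v <- finsupp m) c v * deriv v (term g m).

(* Second-order operator  sum_{v,w} c v w * d^2/(dv dw). *)
Definition ord2 (c : var -> var -> Pol) (g : Pol) : Pol :=
  \sum_(m <- msupp g) \sum_(v <- finsupp m) \sum_(w <- finsupp m)
     c v w * deriv v (deriv w (term g m)).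

Definition ThetaY : Pol -> Pol :=
  ord1 (fun v => match v with inr i => if (0 < i)%N then pv i else 0
                            | inl _ => 0 end).

Definition Yplus : Pol -> Pol :=
  ord1 (fun v => match v with inr i => yv i.+1 | inl _ => 0 end).

(* Lambda_Y = (1+b) sum_{i,j>=1} i y_{i+j-1} d^2/(dp_i dy_{j-1})
            + sum_{i,j>=1} y_{i-1} p_j d/dy_{i+j-1}
            + b sum_{i>=0} i y_i d/dy_i *)
Definition LambdaY (g : Pol) : Pol :=
  cst (1 + bb) *
    ord2 (fun v w => match v, w with
                     | inl i, inr k => if (0 < i)%N then i%:R * yv (i + k) else 0
                     | _, _ => 0 end) g
  + ord1 (fun v => match v with
                   | inr k => \sum_(1 <= i < k.+1) yv i.-1 * pv (k - i).+1
                   | inl _ => 0 end) g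
  + cst bb * ord1 (fun v => match v with
                            | inr i => i%:R * yv i
                            | inl _ => 0 end) g.

(* Laplace-Beltrami operator D_alpha, alpha = 1 + b. *)
Definition Dalpha (g : Pol) : Pol :=
  cst (2^-1) * (
    cst (1 + bb) *
      ord2 (fun v w => match v, w with
                       | inl i, inl j =>
                           if (0 < i)%N && (0 < j)%N
                           then (i * j)%:R * pv (i + j) else 0
                       | _, _ => 0 end) g
    + ord1 (fun v => match v with
                     | inl k => \sum_(1 <= i < k) k%:R * (pv i * pv (k - i))
                     | inr _ => 0 end) g
    + cst bb * ord1 (fun v => match v with
                              | inl i => (i * i.-1)%:R * pv i
                              | inr _ => 0 end) g).

(* A_{j+1} f = Theta_Y Y_+ Lambda_Y^j (y_0 f / (1+b)), j >= 0;
   A 0 is an unused dummy. *)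
Definition Aop (j : nat) (f : Pol) : Pol :=
  match j with
  | 0 => 0
  | j'.+1 => ThetaY (Yplus (iter j' LambdaY (cst (1 + bb)^-1 * yv 0 * f)))
  end.

(* Main.v *)
(* Put q_0 = 0, q_i = p_i, J_i = i d/dp_i, and let T = Theta_Y Y_+, which
   replaces y_k by p_{k+1}.  On elements linear in the y's, define
     E (y_k u) = (1+b) k sum_i y_{k+i} J_i u + sum_{j<=k} (k-j) y_{k-j} q_j u
                 + b k(k-1)/2 y_k u.
   If y_k is read as z^k and N = z d/dz, then Lambda_Y = X + Y + bN and
   E = XN + NY + b N(N-1)/2, with X = (1+b) sum_i z^i J_i and
   Y = sum_j z^{-j} q_j truncated to nonnegative powers of z.  A direct
   computation gives [D_alpha + E, Lambda_Y] = 0, and symmetrizing the sums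
   gives D_alpha T = T (D_alpha + E) + T Lambda_Y.  Since E kills y_0 u,
     [D_alpha, A_j] f = T (D_alpha + E) Lambda_Y^{j-1} (y_0 f / (1+b)) + A_{j+1} f
                        - T Lambda_Y^{j-1} (D_alpha + E) (y_0 f / (1+b))
   and the commutation of D_alpha + E with Lambda_Y leaves A_{j+1} f. *)

Require Import Defs.
From HB Require Import structures.
From mathcomp Require Import all_boot all_order all_algebra.
From mathcomp Require Import finmap.
From mathcomp.multinomials Require Import monalg.
From mathcomp Require Import ring zify.

Set Implicit Arguments.
Unset Strict Implicit.
Unset Printing Implicit Defensive.

Import GRing.Theory.
Local Open Scope ring_scope.

(** * Finite sums *)

(** Both sums equal the sum over the common entries, up to a permutation. This is how the list of
    variables in a differential operator gets changed. *)
Lemma big_seq_support (V : nmodType) (I : eqType) (s t : seq I) (F : I -> V) :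
  uniq s -> uniq t ->
  (forall i, i \in s -> i \notin t -> F i = 0) ->
  (forall i, i \in t -> i \notin s -> F i = 0) ->
  \sum_(i <- s) F i = \sum_(i <- t) F i.
Proof.
have restr (r r' : seq I) : (forall i, i \in r -> i \notin r' -> F i = 0) ->
    \sum_(i <- r) F i = \sum_(i <- [seq i <- r | i \in r']) F i.
  move=> h; rewrite big_filter (bigID (mem r')) /= [X in _ + X]big1_seq ?addr0 //.
  by move=> i /andP[ir' ir]; apply: h.
move=> us ut hs ht; rewrite (restr s t) // (restr t s) //.
apply/perm_big/uniq_perm; rewrite ?filter_uniq // => i.
by rewrite !mem_filter andbC.
Qed.

Section Reindexing.
Variable V : nmodType.

(** Raising [M] by one lengthens every row by one entry and adds a row of length one; together these
    form the new antidiagonal. *)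
Lemma sum_triangle (F : nat -> nat -> V) M :
  \sum_(0 <= i < M) \sum_(0 <= l < M - i) F i l
  = \sum_(0 <= n < M) \sum_(0 <= l < n.+1) F (n - l)%N l.
Proof.
elim: M => [|M IH]; first by rewrite !big_geq.
rewrite [RHS]big_nat_recr //= -IH [LHS]big_nat_recr //= subSn // subnn.
under eq_big_nat => i /andP[_ iM].
  rewrite subSn; last exact: ltnW.
  rewrite big_nat_recr //=.
  over.
rewrite big_split /= -addrA; congr (_ + _).
rewrite big_nat1 [RHS]big_nat_rev [RHS]big_nat_recr //= add0n subnn subn0.
congr (_ + _); apply: eq_big_nat => i /andP[_ iM].
by rewrite subSS subKn // ltnW.
Qed.

Lemma sum_antidiagonal (F : nat -> nat -> V) M :
  (forall i l, (M <= i + l)%N -> F i l = 0) ->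
  \sum_(0 <= i < M) \sum_(0 <= l < M) F i l
  = \sum_(0 <= n < M) \sum_(0 <= l < n.+1) F (n - l)%N l.
Proof.
move=> F0; rewrite -sum_triangle; apply: eq_big_nat => i /andP[_ iM].
rewrite (big_cat_nat (n := (M - i)%N)) ?leq_subr //= [X in _ + X]big_nat_cond.
rewrite [X in _ + X]big1 ?addr0 // => l /andP[/andP[h _] _]; apply: F0.
by rewrite -leq_subLR.
Qed.

End Reindexing.

Lemma sum_delta (R : nzRingType) (F : nat -> R) j M : (j < M)%N ->
  \sum_(0 <= i < M) F i * (i * (i == j))%:R = F j * j%:R.
Proof.
move=> jM; rewrite (bigD1_seq j) ?iota_uniq ?mem_index_iota //= eqxx muln1.
by rewrite big1 ?addr0 // => i /negPf->; rewrite muln0 mulr0.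
Qed.

(** * The commutation relations over an abstract ring *)

Section LaplaceBeltrami.
(** [J i] models i d/dp_i, [q i] models p_i, and [a], [b], [h] model 1 + b, b and 1/2. *)
Variables (R : comNzRingType) (J : nat -> R -> R) (q : nat -> R) (a b h : R).
Hypothesis JD : forall i u v, J i (u + v) = J i u + J i v.
Hypothesis JM : forall i u v, J i (u * v) = J i u * v + u * J i v.
Hypothesis JC : forall i j u, J i (J j u) = J j (J i u).
Hypothesis Jq : forall i j, J i (q j) = (i * (i == j))%:R.
Hypothesis Ja : forall i, J i a = 0.
Hypothesis Jb : forall i, J i b = 0.
Hypothesis Jh : forall i, J i h = 0.
Hypothesis h2 : h * 2 = 1.

Lemma J_0 i : J i 0 = 0.
Proof. by apply: (addrI (J i 0)); rewrite -JD !addr0. Qed.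

Lemma J_sum i (I : Type) (r : seq I) (F : I -> R) :
  J i (\sum_(k <- r) F k) = \sum_(k <- r) J i (F k).
Proof. exact: (big_morph (J i) (JD i) (J_0 i)). Qed.

Lemma J_1 i : J i 1 = 0.
Proof. by apply: (addrI (J i 1)); rewrite addr0 -{3}(mulr1 1) JM mulr1 mul1r. Qed.

Lemma J_nat i n : J i n%:R = 0.
Proof. by elim: n => [|n IH]; rewrite ?J_0 // -natr1 JD IH J_1 addr0. Qed.

Lemma J_opp i u : J i (- u) = - J i u.
Proof. by apply: (addrI (J i u)); rewrite -JD !subrr J_0. Qed.

(** Reversing the sum swaps the weights n - l and l, which add up to n, so twice the left side is n
    times the unweighted sum. *)
Lemma sum_symm (G : nat -> nat -> R) n : (forall i j, G i j = G j i) ->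
  \sum_(0 <= l < n.+1) (n - l)%:R * G l (n - l)%N
  = h * n%:R * \sum_(0 <= l < n.+1) G l (n - l)%N.
Proof.
move=> GC; set S := LHS; set T := \sum_(_ <= _ < _) G _ _.
suff E : n%:R * T = 2 * S by rewrite -mulrA E; ring: h2.
have -> : 2 * S = S + S by ring.
rewrite {2}/S big_nat_rev -big_split /= big_distrr /=.
apply: eq_big_nat => l /andP[_ ln]; rewrite add0n subSS subKn // (GC (n - l)%N).
by rewrite -mulrDl -natrD subnK.
Qed.

Lemma sum_symm_r (G : nat -> nat -> R) n : (forall i j, G i j = G j i) ->
  \sum_(0 <= l < n.+1) l%:R * G l (n - l)%N
  = h * n%:R * \sum_(0 <= l < n.+1) G l (n - l)%N.
Proof.
move=> /(sum_symm n) => E; set T := \sum_(_ <= _ < _) G _ _ in E *.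
transitivity (n%:R * T - h * n%:R * T); last by rewrite -[n%:R * T]mul1r -h2; ring.
rewrite -E big_distrr -sumrB; apply: eq_big_nat => l /andP[_ ln] /=.
by rewrite natrB //; ring.
Qed.

(** * Truncated operators and their commutators with q_j and J_k *)

Section Truncated.
Variables (y : nat -> R) (M : nat).

(* The sums are truncated at M, which loses nothing when J_i u = 0 for i >= M;
   they may start at 0 because J_0 = 0 and q_0 = 0 in the application. *)
Definition LB u :=
  h * (a * (\sum_(0 <= i < M) \sum_(0 <= j < M) q (i + j)%N * J i (J j u))
     + \sum_(0 <= k < M) (\sum_(0 <= i < k.+1) q i * q (k - i)%N) * J k u
     + b * \sum_(0 <= i < M) (i%:R - 1) * q i * J i u).

(** The extra terms are those where a derivative falls on [q j], giving the factor j. In the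
    second-order part either of the two derivatives can do so; [h] cancels the resulting factor
    2. *)
Lemma LB_q j u : (j < M)%N -> LB (q j * u) = q j * LB u +
  j%:R * (a * (\sum_(0 <= i < M) q (i + j)%N * J i u)
        + h * (\sum_(0 <= i < j.+1) q i * q (j - i)%N) * u
        + b * h * (j%:R - 1) * q j * u).
Proof.
move=> jM; rewrite /LB.
have -> : \sum_(0 <= i < M) \sum_(0 <= l < M) q (i + l)%N * J i (J l (q j * u))
  = q j * (\sum_(0 <= i < M) \sum_(0 <= l < M) q (i + l)%N * J i (J l u))
    + 2 * j%:R * \sum_(0 <= i < M) q (i + j)%N * J i u.
  rewrite -mulrA mulr_natl mulr2n.
  rewrite [q j * \sum_(_ <= _ < _) _]big_distrr.
  rewrite [j%:R * \sum_(_ <= _ < _) _]big_distrr /=.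
  rewrite {1}[X in _ + (X + _)](_ : _ = \sum_(0 <= i < M) \sum_(0 <= l < M)
     (q (i + l)%N * J l u) * (i * (i == j))%:R); last first.
    rewrite exchange_big /=; apply: eq_bigr => i _.
    by rewrite sum_delta // addnC mulrC.
  rewrite -!big_split; apply: eq_bigr => i _ /=.
  rewrite [q j * \sum_(_ <= _ < _) _]big_distrr /= [j%:R * (_ * _)]mulrC.
  rewrite -(sum_delta (fun l => q (i + l)%N * J i u) jM) -!big_split.
  apply: eq_bigr => l _ /=.
  by rewrite !(JM, JD, Jq, J_nat); ring.
have -> : \sum_(0 <= k < M) (\sum_(0 <= i < k.+1) q i * q (k - i)%N) * J k (q j * u)
  = q j * (\sum_(0 <= k < M) (\sum_(0 <= i < k.+1) q i * q (k - i)%N) * J k u)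
    + j%:R * (\sum_(0 <= i < j.+1) q i * q (j - i)%N) * u.
  rewrite [q j * \sum_(_ <= _ < _) _]big_distrr -[X in _ + X]mulrA [X in _ + X]mulrC.
  rewrite -(sum_delta (fun k => (\sum_(0 <= i < k.+1) q i * q (k - i)%N) * u) jM).
  rewrite -big_split; apply: eq_bigr => i _ /=.
  by rewrite JM Jq; ring.
have -> : \sum_(0 <= i < M) (i%:R - 1) * q i * J i (q j * u)
  = q j * (\sum_(0 <= i < M) (i%:R - 1) * q i * J i u)
    + j%:R * ((j%:R - 1) * q j * u).
  rewrite [q j * \sum_(_ <= _ < _) _]big_distrr [X in _ + X]mulrC.
  rewrite -(sum_delta (fun i => (i%:R - 1) * q i * u) jM).
  rewrite -big_split; apply: eq_bigr => i _ /=.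
  by rewrite JM Jq; ring.
ring: h2.
Qed.

(** The [J i] commute, so the correction comes from [J k] hitting the factors [q] inside [LB]. The
    bound on [u] discards the J_{k+l} u beyond the truncation. *)
Lemma LB_J k u : (k < M)%N -> (forall i, (M <= i)%N -> J i u = 0) ->
  LB (J k u) = J k (LB u) -
  k%:R * (a * h * (\sum_(0 <= l < k.+1) J l (J (k - l)%N u))
        + (\sum_(0 <= l < M) q l * J (k + l)%N u)
        + b * h * (k%:R - 1) * J k u).
Proof.
move=> kM uM.
have Jlin c v : (forall i, J i c = 0) -> J k (c * v) = c * J k v.
  by move=> cJ; rewrite JM cJ mul0r add0r.
rewrite /LB (Jlin h) // !JD (Jlin a) // (Jlin b) //.
have -> : J k (\sum_(0 <= i < M) \sum_(0 <= j < M) q (i + j)%N * J i (J j u))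
  = \sum_(0 <= i < M) \sum_(0 <= j < M) q (i + j)%N * J i (J j (J k u))
    + k%:R * \sum_(0 <= l < k.+1) J l (J (k - l)%N u).
  (* Differentiating q_{i+j} selects i + j = k; since k < M this antidiagonal lies inside the
     truncated square. *)
  have -> : k%:R * \sum_(0 <= l < k.+1) J l (J (k - l)%N u) =
      \sum_(0 <= i < M) \sum_(0 <= j < M) (k * (k == i + j)%N)%:R * J i (J j u).
    transitivity (\sum_(0 <= i < k.+1) k%:R * J i (J (k - i)%N u)).
      by rewrite big_distrr.
    rewrite [RHS](big_cat_nat (n := k.+1)) //= [X in _ + X]big1_seq ?addr0; last first.
      move=> i /andP[_]; rewrite mem_index_iota => /andP[ki _].
      apply: big1 => j _; rewrite (_ : (k == _) = false) ?muln0 ?mul0r //; lia.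
    apply: eq_big_nat => i /andP[_ ik].
    rewrite (bigD1_seq (k - i)%N) ?iota_uniq ?mem_index_iota //=; last by lia.
    rewrite subnKC // eqxx muln1 big1 ?addr0 // => j jk.
    by rewrite (_ : (k == _) = false) ?muln0 ?mul0r //; lia.
  rewrite J_sum -big_split; apply: eq_bigr => i _ /=.
  rewrite J_sum -big_split; apply: eq_bigr => j _ /=.
  by rewrite JM Jq (JC k i) (JC k j); ring.
have -> : J k (\sum_(0 <= n < M) (\sum_(0 <= i < n.+1) q i * q (n - i)%N) * J n u)
  = \sum_(0 <= n < M) (\sum_(0 <= i < n.+1) q i * q (n - i)%N) * J n (J k u)
    + 2 * k%:R * \sum_(0 <= l < M) q l * J (k + l)%N u.
  rewrite J_sum.
  transitivity (\sum_(0 <= n < M) ((\sum_(0 <= i < n.+1) q i * q (n - i)%N) * J n (J k u)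
     + 2 * \sum_(0 <= i < n.+1) (k * (k == n - i)%N)%:R * q i * J n u)).
    apply: eq_bigr => n _; rewrite JM (JC k n) addrC; congr (_ + _).
    rewrite J_sum big_distrl /=.
    (* The factors q_i and q_{n-i} contribute equally after reversing the sum. *)
    have -> : 2 * \sum_(0 <= i < n.+1) (k * (k == n - i)%N)%:R * q i * J n u =
      \sum_(0 <= i < n.+1) (k * (k == i)%N)%:R * q (n - i)%N * J n u +
      \sum_(0 <= i < n.+1) (k * (k == n - i)%N)%:R * q i * J n u.
      rewrite mulr_natl mulr2n; congr (_ + _); rewrite big_nat_rev /=.
      by apply: eq_big_nat => i /andP[_ im]; rewrite add0n subSS subKn.
    by rewrite -big_split; apply: eq_bigr => i _ /=; rewrite JM !Jq; ring.
  rewrite big_split /= -big_distrr -mulrA /=; congr (_ + 2 * _).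
  (* With m = n - l the triangle becomes a square in which only the row m = k survives. *)
  pose F m l := (k * (k == m)%N)%:R * q l * J (m + l)%N u.
  transitivity (\sum_(0 <= n < M) \sum_(0 <= l < n.+1) F (n - l)%N l).
    apply: eq_bigr => n _; apply: eq_big_nat => l /andP[_ ln].
    by rewrite /F subnK.
  rewrite -(sum_antidiagonal (F := F)); last by move=> m l ml; rewrite /F uM ?mulr0.
  rewrite exchange_big big_distrr; apply: eq_bigr => l _ /=.
  rewrite mulrC -(sum_delta (fun m => q l * J (m + l)%N u) kM).
  by apply: eq_bigr => m _; rewrite /F eq_sym; case: eqP => [->|_]; rewrite ?muln0; ring.
have -> : J k (\sum_(0 <= i < M) (i%:R - 1) * q i * J i u)
  = \sum_(0 <= i < M) (i%:R - 1) * q i * J i (J k u) + k%:R * ((k%:R - 1) * J k u).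
  rewrite [X in _ + X]mulrC -(sum_delta (fun i => (i%:R - 1) * J i u) kM).
  rewrite J_sum -big_split; apply: eq_bigr => i _ /=.
  rewrite !(JM, JD, J_opp, Jq, J_nat, J_1) (JC k i) eq_sym.
  by case: eqP => [->|_]; rewrite ?muln0; ring.
ring: h2.
Qed.

(* [Lam k u] and [Ext k u] are the values at y_k u of Lambda_Y and of the
   auxiliary operator E. *)
Definition Lam k u :=
  a * (\sum_(0 <= i < M) y (k + i)%N * J i u)
  + \sum_(0 <= j < k.+1) y (k - j)%N * q j * u + b * k%:R * y k * u.

Definition Ext k u :=
  a * k%:R * (\sum_(0 <= i < M) y (k + i)%N * J i u)
  + \sum_(0 <= j < k.+1) (k - j)%:R * y (k - j)%N * q j * u
  + b * h * k%:R * (k%:R - 1) * y k * u.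

(** Coefficient of a^2 in [LB_Ext_Lam]. The weights leave (k + i) - k = i, which [sum_symm] averages
    to half the antidiagonal index because the [J i] commute. *)
Lemma Ext_Lam_JJ k u : (forall i l, (M <= i + l)%N -> J i (J l u) = 0) ->
  \sum_(0 <= i < M) (k + i)%:R * (\sum_(0 <= l < M) y (k + i + l)%N * J l (J i u))
  - k%:R * \sum_(0 <= i < M) \sum_(0 <= l < M) y (k + i + l)%N * J l (J i u)
  = h * \sum_(0 <= i < M) i%:R * y (k + i)%N * \sum_(0 <= l < i.+1) J l (J (i - l)%N u).
Proof.
move=> uM; rewrite big_distrr /= -sumrB.
transitivity (\sum_(0 <= i < M) \sum_(0 <= l < M)
    i%:R * (y (k + (i + l))%N * J l (J i u))).
  apply: eq_bigr => i _; rewrite -mulrBl natrD addrAC subrr add0r big_distrr.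
  by apply: eq_bigr => l _; rewrite addnA.
rewrite (sum_antidiagonal (F := fun i l => i%:R * (y (k + (i + l))%N * J l (J i u)))).
  rewrite big_distrr; apply: eq_bigr => n _ /=.
  have := sum_symm (G := fun i l => J i (J l u)) n (fun i l => JC i l u).
  rewrite /= mulrCA -!mulrA => E.
  rewrite [RHS](_ : _ =
    y (k + n)%N * (h * (n%:R * \sum_(0 <= l < n.+1) J l (J (n - l)%N u))));
    last by ring.
  rewrite -E big_distrr; apply: eq_big_nat => l /andP[_ ln].
  by rewrite subnK // mulrCA.
by move=> i l il; rewrite uM ?mulr0 // addnC.
Qed.

(** Coefficient of [a]. The weights leave (k + i - j) - k = i - j; the indices j < i match the
    correction from [LB_J], the indices j >= i the one from [LB_q]. *)
Lemma Ext_Lam_qJ k u : (forall i, (M <= i)%N -> J i u = 0) ->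
  \sum_(0 <= i < M) \sum_(0 <= j < (k + i).+1)
    (k + i - j)%:R * y (k + i - j)%N * q j * J i u
  - k%:R * \sum_(0 <= i < M) \sum_(0 <= j < (k + i).+1) y (k + i - j)%N * q j * J i u
  = \sum_(0 <= i < M) i%:R * y (k + i)%N * (\sum_(0 <= l < M) q l * J (i + l)%N u)
  - \sum_(0 <= j < k.+1) j%:R * y (k - j)%N * (\sum_(0 <= i < M) q (i + j)%N * J i u).
Proof.
move=> uM; pose F m l := m%:R * y (k + m)%N * q l * J (m + l)%N u.
have -> : \sum_(0 <= i < M) i%:R * y (k + i)%N * (\sum_(0 <= l < M) q l * J (i + l)%N u)
    = \sum_(0 <= i < M) \sum_(0 <= j < i) (i%:R - j%:R) * y (k + i - j)%N * q j * J i u.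
  transitivity (\sum_(0 <= n < M) \sum_(0 <= l < n.+1) F (n - l)%N l).
    rewrite -(sum_antidiagonal (F := F)); last by move=> m l ml; rewrite /F uM ?mulr0.
    by apply: eq_bigr => i _; rewrite big_distrr; apply: eq_bigr => l _ /=; rewrite /F; ring.
  (* The index l = n has weight n - l = 0 and is dropped. *)
  apply: eq_bigr => n _; rewrite big_nat_recr //= {2}/F subnn !mul0r addr0.
  apply: eq_big_nat => l /andP[_ ln]; have ln' := ltnW ln.
  by rewrite /F subnK // natrB // addnBA.
have -> : \sum_(0 <= j < k.+1) j%:R * y (k - j)%N * (\sum_(0 <= i < M) q (i + j)%N * J i u)
    = \sum_(0 <= i < M) \sum_(i <= j < (k + i).+1)
        (j%:R - i%:R) * y (k + i - j)%N * q j * J i u.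
  under eq_bigr do rewrite big_distrr.
  rewrite exchange_big; apply: eq_bigr => i _ /=.
  rewrite (big_addn 0 (k + i).+1 i) -addSn addnK; apply: eq_bigr => j _ /=.
  by rewrite subnDr natrD (addnC i) addrK; ring.
rewrite big_distrr /= -!sumrB; apply: eq_bigr => i _ /=.
rewrite big_distrr /= -sumrB (big_cat_nat (n := i)) //=; last by lia.
rewrite -[RHS]addrC -sumrN [RHS]addrC; congr (_ + _);
  apply: eq_big_nat => j /andP[ij jk]; rewrite natrB ?natrD; [ring|lia|ring|lia].
Qed.

(** Part free of [a] and [b]. The weights leave (k - j - l) - (k - j) = -l, and [sum_symm_r]
    averages l to half of n = j + l. *)
Lemma Ext_Lam_qq k u :
  \sum_(0 <= j < k.+1) \sum_(0 <= l < (k - j).+1)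
    (k - j - l)%:R * y (k - j - l)%N * q l * (q j * u)
  - \sum_(0 <= j < k.+1)
      (k - j)%:R * (\sum_(0 <= l < (k - j).+1) y (k - j - l)%N * q l * (q j * u))
  = - (h * \sum_(0 <= j < k.+1)
      j%:R * y (k - j)%N * (\sum_(0 <= i < j.+1) q i * q (j - i)%N)) * u.
Proof.
pose F j l := l%:R * y (k - (j + l))%N * (q l * q j).
transitivity (- (\sum_(0 <= j < k.+1) \sum_(0 <= l < k.+1 - j) F j l) * u).
  rewrite -sumrB -sumrN big_distrl; apply: eq_big_nat => j /andP[_ jk] /=.
  rewrite big_distrr /= -sumrB -sumrN big_distrl -subSn //=.
  apply: eq_big_nat => l /andP[_ lk]; rewrite /F -subnDA.
  by rewrite (_ : (k - j = k - (j + l) + l)%N) ?natrD; [ring|lia].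
rewrite sum_triangle; congr (- _ * _); rewrite big_distrr.
apply: eq_big_nat => n /andP[_ nk] /=.
rewrite (eq_big_nat _ _ (F2 := fun l => y (k - n)%N * (l%:R * (q l * q (n - l)%N)))); last first.
  by move=> l /andP[_ ln]; rewrite /F subnK //; ring.
rewrite -big_distrr /= (sum_symm_r (G := fun i j => q i * q j)); first by ring.
by move=> i j; rewrite mulrC.
Qed.

(** This is [D_alpha + E, Lambda_Y] = 0 at y_k u. After expansion by [LB_J] and [LB_q], the
    coefficients of a^2, a, 1, ab and b are compared; the terms in b^2 agree at once. *)
Lemma LB_Ext_Lam k u : (k < M)%N -> (forall i, (M <= i)%N -> J i u = 0) ->
  (forall i l, (M <= i + l)%N -> J i (J l u) = 0) ->
  a * (\sum_(0 <= i < M) y (k + i)%N * LB (J i u))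
  + \sum_(0 <= j < k.+1) y (k - j)%N * LB (q j * u) + b * k%:R * y k * LB u
  + (a * (\sum_(0 <= i < M) Ext (k + i) (J i u))
  + \sum_(0 <= j < k.+1) Ext (k - j) (q j * u) + b * k%:R * Ext k u)
  = Lam k (LB u)
  + (a * k%:R * (\sum_(0 <= i < M) Lam (k + i) (J i u))
  + \sum_(0 <= j < k.+1) (k - j)%:R * Lam (k - j) (q j * u)
  + b * h * k%:R * (k%:R - 1) * Lam k u).
Proof.
move=> kM uM uMM.
have e1 : \sum_(0 <= i < M) y (k + i)%N * LB (J i u) =
    \sum_(0 <= i < M) y (k + i)%N * J i (LB u)
    - (a * h * (\sum_(0 <= i < M)
           i%:R * y (k + i)%N * \sum_(0 <= l < i.+1) J l (J (i - l)%N u))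
       + (\sum_(0 <= i < M) i%:R * y (k + i)%N * (\sum_(0 <= l < M) q l * J (i + l)%N u))
       + b * h * \sum_(0 <= i < M) i%:R * (i%:R - 1) * y (k + i)%N * J i u).
  rewrite !(big_distrr, =^~ big_split, =^~ sumrB) /=; apply: eq_big_nat => i /andP[_ iM].
  by rewrite LB_J //; ring.
have e2 : \sum_(0 <= j < k.+1) y (k - j)%N * LB (q j * u) =
    \sum_(0 <= j < k.+1) y (k - j)%N * q j * LB u
    + (a * (\sum_(0 <= j < k.+1)
           j%:R * y (k - j)%N * (\sum_(0 <= i < M) q (i + j)%N * J i u))
       + h * (\sum_(0 <= j < k.+1)
           j%:R * y (k - j)%N * (\sum_(0 <= i < j.+1) q i * q (j - i)%N)) * u
       + b * h * \sum_(0 <= j < k.+1) j%:R * (j%:R - 1) * y (k - j)%N * q j * u).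
  rewrite -[h * _ * u]mulrA [_ * u]big_distrl /=.
  rewrite ![_ * \sum_(0 <= _ < k.+1) _]big_distrr -!big_split /=.
  apply: eq_big_nat => j /andP[_ jk]; rewrite LB_q; last exact: leq_trans jk kM.
  by ring.
set X := fun k v => \sum_(0 <= i < M) y (k + i)%N * J i v.
set Y := fun k v => \sum_(0 <= j < k.+1) y (k - j)%N * q j * v.
have e3 : \sum_(0 <= i < M) Ext (k + i) (J i u) =
    a * (\sum_(0 <= i < M) (k + i)%:R * X (k + i)%N (J i u))
    + \sum_(0 <= i < M) \sum_(0 <= j < (k + i).+1) (k + i - j)%:R * y (k + i - j)%N * q j * J i u
    + b * h * \sum_(0 <= i < M) (k + i)%:R * ((k + i)%:R - 1) * y (k + i)%N * J i u.
  rewrite ![_ * \sum_(0 <= _ < M) _]big_distrr -!big_split /=.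
  by apply: eq_big_nat => i _; rewrite /Ext /X; ring.
have e4 : \sum_(0 <= i < M) Lam (k + i) (J i u) =
    a * (\sum_(0 <= i < M) X (k + i)%N (J i u))
    + \sum_(0 <= i < M) Y (k + i)%N (J i u)
    + b * \sum_(0 <= i < M) (k + i)%:R * y (k + i)%N * J i u.
  rewrite ![_ * \sum_(0 <= _ < M) _]big_distrr -!big_split /=.
  by apply: eq_big_nat => i _; rewrite /Lam /X /Y; ring.
have e5 : \sum_(0 <= j < k.+1) Ext (k - j) (q j * u) =
    a * (\sum_(0 <= j < k.+1) (k - j)%:R * X (k - j)%N (q j * u))
    + \sum_(0 <= j < k.+1) \sum_(0 <= l < (k - j).+1)
        (k - j - l)%:R * y (k - j - l)%N * q l * (q j * u)
    + b * h * \sum_(0 <= j < k.+1) (k - j)%:R * ((k - j)%:R - 1) * y (k - j)%N * q j * u.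
  rewrite ![_ * \sum_(0 <= _ < k.+1) _]big_distrr -!big_split /=.
  by apply: eq_big_nat => j _; rewrite /Ext /X; ring.
have e6 : \sum_(0 <= j < k.+1) (k - j)%:R * Lam (k - j) (q j * u) =
    a * (\sum_(0 <= j < k.+1) (k - j)%:R * X (k - j)%N (q j * u))
    + \sum_(0 <= j < k.+1) (k - j)%:R * Y (k - j)%N (q j * u)
    + b * \sum_(0 <= j < k.+1) (k - j)%:R * (k - j)%:R * y (k - j)%N * q j * u.
  rewrite ![_ * \sum_(0 <= _ < k.+1) _]big_distrr -!big_split /=.
  by apply: eq_big_nat => j _; rewrite /Lam /X /Y; ring.
have i1 := Ext_Lam_JJ k uMM.
have i2 := Ext_Lam_qJ k uM.
have i3 := Ext_Lam_qq k u.
(* Coefficient of ab: termwise, (k+i)(k+i-1) = k(k-1) + i(i-1) + 2ki and h * 2 = 1. *)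
have i4 : - (h * \sum_(0 <= i < M) i%:R * (i%:R - 1) * y (k + i)%N * J i u)
    + h * (\sum_(0 <= i < M) (k + i)%:R * ((k + i)%:R - 1) * y (k + i)%N * J i u)
    - k%:R * (\sum_(0 <= i < M) (k + i)%:R * y (k + i)%N * J i u)
    + (k%:R * k%:R - h * k%:R * (k%:R - 1)) * X k u = 0.
  rewrite /X ![_ * \sum_(0 <= _ < M) _]big_distrr -!sumrN -!big_split /=.
  apply: big1 => i _.
  transitivity ((1 - h * 2) * - (k%:R * i%:R * (y (k + i)%N * J i u))).
    by rewrite natrD; ring.
  by rewrite h2 subrr mul0r.
(* Coefficient of b: the same identity for the splitting k = j + (k - j). *)
have i5 : h * (\sum_(0 <= j < k.+1) j%:R * (j%:R - 1) * y (k - j)%N * q j * u)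
    + h * (\sum_(0 <= j < k.+1) (k - j)%:R * ((k - j)%:R - 1) * y (k - j)%N * q j * u)
    + k%:R * (\sum_(0 <= j < k.+1) (k - j)%:R * y (k - j)%N * q j * u)
    - \sum_(0 <= j < k.+1) (k - j)%:R * (k - j)%:R * y (k - j)%N * q j * u
    - h * k%:R * (k%:R - 1) * Y k u = 0.
  rewrite /Y ![_ * \sum_(0 <= _ < k.+1) _]big_distrr -!sumrN -!big_split /=.
  apply: big1_seq => j /andP[_]; rewrite mem_index_iota ltnS => /andP[_ jk].
  transitivity ((1 - h * 2) * (j%:R * (k - j)%:R * (y (k - j)%N * (q j * u)))).
    by rewrite natrB //; ring.
  by rewrite h2 subrr mul0r.
(* The difference of the two sides is this combination of the five vanishing expressions, an
   identity left to [ring]. *)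
have comb z1 z2 z3 z4 z5 : z1 = 0 -> z2 = 0 -> z3 = 0 -> z4 = 0 -> z5 = 0 ->
    a * a * z1 + a * z2 + z3 + a * b * z4 + b * z5 = 0.
  by move=> -> -> -> -> ->; rewrite !mulr0 !addr0.
move/eqP: i1; rewrite -subr_eq0 => /eqP i1.
move/eqP: i2; rewrite -subr_eq0 => /eqP i2.
move/eqP: i3; rewrite -subr_eq0 => /eqP i3.
apply: subr0_eq; apply: etrans (comb _ _ _ _ _ i1 i2 i3 i4 i5).
rewrite e1 e2 e3 e4 e5 e6 /Ext /Lam /X /Y; ring.
Qed.

(** This is D_alpha T = T (D_alpha + E) + T Lambda_Y at y_k u, with [y] already replaced by the
    shifted [q]. Reading [sum_symm] backwards produces the weight k + 1 - j = (k - j) + 1, whose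
    summands belong to [Ext] and [Lam]. *)
Lemma LB_qS k u : y =1 (fun n => q n.+1) -> (k.+1 < M)%N ->
  LB (q k.+1 * u) = q k.+1 * LB u + (Ext k u + Lam k u).
Proof.
move=> yq kM; rewrite LB_q //; congr (_ + _).
have -> : k.+1%:R * (a * (\sum_(0 <= i < M) q (i + k.+1)%N * J i u)
      + h * (\sum_(0 <= i < k.+2) q i * q (k.+1 - i)%N) * u
      + b * h * (k.+1%:R - 1) * q k.+1 * u)
    = a * k.+1%:R * (\sum_(0 <= i < M) q (i + k.+1)%N * J i u)
      + h * k.+1%:R * (\sum_(0 <= i < k.+2) q i * q (k.+1 - i)%N) * u
      + b * h * k.+1%:R * k%:R * q k.+1 * u by rewrite -natr1; ring.
rewrite -(sum_symm (G := fun i j => q i * q j)) => [|i j]; last by rewrite mulrC.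
rewrite big_nat_recr //= subnn mul0r addr0 big_distrl.
have -> : Ext k u + Lam k u =
    a * k.+1%:R * (\sum_(0 <= i < M) y (k + i)%N * J i u)
    + (\sum_(0 <= j < k.+1) (k - j)%:R * y (k - j)%N * q j * u
       + \sum_(0 <= j < k.+1) y (k - j)%N * q j * u)
    + b * h * k.+1%:R * k%:R * y k * u.
  rewrite /Ext /Lam -natr1.
  (* Inserting h * 2 = 1 into the b-term of [Lam] gives h k (k - 1) + 2 h k = h (k + 1) k. *)
  transitivity (a * k%:R * (\sum_(0 <= i < M) y (k + i)%N * J i u)
    + \sum_(0 <= j < k.+1) (k - j)%:R * y (k - j)%N * q j * u
    + b * h * k%:R * (k%:R - 1) * y k * u
    + (a * (\sum_(0 <= i < M) y (k + i)%N * J i u)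
    + \sum_(0 <= j < k.+1) y (k - j)%N * q j * u + b * (h * 2) * k%:R * y k * u)).
    by rewrite h2 mulr1.
  ring.
rewrite yq -big_split /=; congr (_ * _ + _ + _).
  by apply: eq_bigr => i _; rewrite yq -addSn addnC.
apply: eq_big_nat => j /andP[_ jk]; rewrite yq subSn // -natr1; ring.
Qed.

(** Assumed only after [LB_qS], where [y] is a shift of [q] and [J i] acts on it by [Jq]. *)
Hypothesis Jy : forall i j, J i (y j) = 0.

Lemma LB_y k u : LB (y k * u) = y k * LB u.
Proof.
have Jyu i v : J i (y k * v) = y k * J i v by rewrite JM Jy mul0r add0r.
rewrite /LB mulrCA; congr (h * _); rewrite !mulrDr; congr (_ + _ + _).
- rewrite [RHS]mulrCA; congr (a * _); rewrite big_distrr; apply: eq_bigr => i _ /=.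
  by rewrite big_distrr; apply: eq_bigr => j _ /=; rewrite !Jyu [RHS]mulrCA.
- by rewrite big_distrr; apply: eq_bigr => i _ /=; rewrite Jyu [RHS]mulrCA.
- rewrite [RHS]mulrCA; congr (b * _); rewrite big_distrr.
  by apply: eq_bigr => i _ /=; rewrite Jyu [RHS]mulrCA.
Qed.

End Truncated.

Definition bounded M u := forall i, (M <= i)%N -> J i u = 0.

Lemma bounded_leq M N u : (M <= N)%N -> bounded M u -> bounded N u.
Proof. by move=> MN uM i Ni; apply: uM; exact: leq_trans Ni. Qed.

Lemma bounded_J M i u : bounded M u -> bounded M (J i u).
Proof. by move=> uM l Ml; rewrite JC uM // J_0. Qed.

Lemma bounded_q M j u : (j < M)%N -> bounded M u -> bounded M (q j * u).
Proof.
move=> jM uM i Mi; rewrite JM uM // Jq mulr0 addr0.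
rewrite (_ : (i == j) = false) ?muln0 ?mul0r //; apply/negbTE.
by rewrite gtn_eqF // (leq_trans jM).
Qed.

(** * Operator identities on the span of the y_k u *)

Section Operators.
(** [D], [L], [E], [T] model D_alpha, Lambda_Y, the auxiliary E and Theta_Y Y_+. [DE], [LE] and [EE]
    hold for every bound [M] of [u], so [M] can be enlarged at will. *)
Variables (y : nat -> R) (D L E T : R -> R) (scalar yfree : R -> Prop).
Hypothesis Jy : forall i j, J i (y j) = 0.
Hypothesis sa : scalar a.
Hypothesis sb : scalar b.
Hypothesis sh : scalar h.
Hypothesis sn : forall n, scalar n%:R.
Hypothesis sM : forall c d, scalar c -> scalar d -> scalar (c * d).
Hypothesis yfJ : forall i u, yfree u -> yfree (J i u).
Hypothesis yfq : forall j u, yfree u -> yfree (q j * u).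
Hypothesis yfD : forall u, yfree u -> yfree (D u).
Hypothesis boundP : forall u, exists M, bounded M u.

Definition scalar_linear (X : R -> R) :=
  (forall u v, X (u + v) = X u + X v) /\ (forall c u, scalar c -> X (c * u) = c * X u).

Hypothesis lD : scalar_linear D.
Hypothesis lL : scalar_linear L.
Hypothesis lE : scalar_linear E.
Hypothesis lT : scalar_linear T.
Hypothesis DE : forall M u, bounded M u -> D u = LB M u.
Hypothesis LE : forall M k u, yfree u -> bounded M u -> L (y k * u) = Lam y M k u.
Hypothesis EE : forall M k u, yfree u -> bounded M u -> E (y k * u) = Ext y M k u.
Hypothesis TE : forall k u, yfree u -> T (y k * u) = q k.+1 * u.

(** An inductive span, so that identities between linear operators reduce to the generators y_k
    u. *)
Inductive linear_in_y : R -> Prop :=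
| Lin_y k u : yfree u -> linear_in_y (y k * u)
| Lin_0 : linear_in_y 0
| Lin_D u v : linear_in_y u -> linear_in_y v -> linear_in_y (u + v)
| Lin_Z c u : scalar c -> linear_in_y u -> linear_in_y (c * u).

Lemma scalar_linear0 X : scalar_linear X -> X 0 = 0.
Proof. by move=> [XD _]; apply: (addrI (X 0)); rewrite -XD !addr0. Qed.

Lemma scalar_linear_sum X (I : Type) (r : seq I) (F : I -> R) : scalar_linear X ->
  X (\sum_(i <- r) F i) = \sum_(i <- r) X (F i).
Proof. by move=> lX; exact: (big_morph X (proj1 lX) (scalar_linear0 lX)). Qed.

Lemma scalar_linear_Lam X M k u : scalar_linear X ->
  X (Lam y M k u) = a * (\sum_(0 <= i < M) X (y (k + i)%N * J i u))
   + \sum_(0 <= j < k.+1) X (y (k - j)%N * (q j * u)) + b * k%:R * X (y k * u).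
Proof.
move=> lX; have [XD XZ] := lX; rewrite /Lam !XD -[b * _ * _ * u]mulrA.
rewrite (XZ a) // (XZ (b * _)); last exact: sM.
rewrite !(scalar_linear_sum _ _ lX); congr (_ + _ + _).
by apply: eq_bigr => j _; rewrite mulrA.
Qed.

Lemma scalar_linear_Ext X M k u : scalar_linear X ->
  X (Ext y M k u) = a * k%:R * (\sum_(0 <= i < M) X (y (k + i)%N * J i u))
   + \sum_(0 <= j < k.+1) (k - j)%:R * X (y (k - j)%N * (q j * u))
   + b * h * k%:R * (k%:R - 1) * X (y k * u).
Proof.
move=> lX; have [XD XZ] := lX.
(* [scalar] is assumed closed under products but not differences, so k (k - 1) becomes the natural
   number k * k.-1; both vanish at k = 0. *)
have -> : Ext y M k u = a * k%:R * (\sum_(0 <= i < M) y (k + i)%N * J i u)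
  + \sum_(0 <= j < k.+1) (k - j)%:R * (y (k - j)%N * (q j * u))
  + b * h * (k * k.-1)%:R * (y k * u).
  rewrite /Ext; congr (_ + _ + _); first by apply: eq_bigr => j _; rewrite !mulrA.
  by case: k => [|k] /=; rewrite ?natrM -?natr1; ring.
rewrite !XD (XZ (a * _)) ?(XZ (b * h * _)); do ?by auto.
rewrite !(scalar_linear_sum _ _ lX); congr (_ + _ + _).
  by apply: eq_bigr => j _; rewrite XZ.
by case: k => [|k] /=; rewrite ?natrM -?natr1; ring.
Qed.

Lemma linear_in_y_sum (I : Type) (r : seq I) (F : I -> R) :
  (forall i, linear_in_y (F i)) -> linear_in_y (\sum_(i <- r) F i).
Proof. by move=> FL; apply: (big_ind linear_in_y) => //; [exact: Lin_0|exact: Lin_D]. Qed.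

(** The summands of [Lam] are again scalars times some y_n times a y-free factor, so powers of [L]
    stay in the span. *)
Lemma linear_in_y_L x : linear_in_y x -> linear_in_y (L x).
Proof.
elim=> [k u yu||u v _ Lu _ Lv|c u sc _ Lu].
- have [M uM] := boundP u; rewrite (LE _ yu uM) /Lam -[b * _ * _ * _]mulrA.
  apply: Lin_D; first apply: Lin_D.
  + by apply/Lin_Z/linear_in_y_sum => // i; apply/Lin_y/yfJ.
  + by apply: linear_in_y_sum => j; rewrite -mulrA; apply/Lin_y/yfq.
  + by apply/Lin_Z/Lin_y => //; exact: sM.
- by rewrite (scalar_linear0 lL); exact: Lin_0.
- by rewrite (proj1 lL); exact: Lin_D.
- by rewrite (proj2 lL) //; exact: Lin_Z.
Qed.

Lemma D_y k u : D (y k * u) = y k * D u.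
Proof.
have [M uM] := boundP u; rewrite (DE uM) -LB_y //; apply: DE => i Mi.
by rewrite JM Jy uM // mul0r mulr0 addr0.
Qed.

Lemma commute_y k u : yfree u ->
  D (L (y k * u)) + E (L (y k * u)) = L (D (y k * u)) + L (E (y k * u)).
Proof.
move=> yu; have [M0 uM0] := boundP u; have [M1 DM1] := boundP (D u).
(* Two copies of [M0] force i or l to reach [M0] once i + l >= M; k + 1 covers the q_j u with j <=
   k, and [M1] covers D u. *)
pose M := (k.+1 + M0 + M0 + M1)%N.
have kM : (k < M)%N by rewrite /M; lia.
have uM : bounded M u by apply: bounded_leq uM0; rewrite /M; lia.
have DM : bounded M (D u) by apply: bounded_leq DM1; rewrite /M; lia.
have qM j : (j < k.+1)%N -> bounded M (q j * u).
  by move=> jk; apply: bounded_q => //; exact: leq_trans jk kM.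
have uMM i l : (M <= i + l)%N -> J i (J l u) = 0.
  case: (leqP M0 l) => [lM _|lM iM]; first by rewrite uM0 // J_0.
  by rewrite JC uM0 ?J_0 //; move: iM; rewrite /M; lia.
have := LB_Ext_Lam y kM uM uMM.
rewrite D_y (LE k yu uM) (LE k (yfD yu) DM) (EE k yu uM).
rewrite (scalar_linear_Lam _ _ _ lD) (scalar_linear_Lam _ _ _ lE) (scalar_linear_Ext _ _ _ lL).
rewrite -(DE uM) (LE k yu uM) (EE k yu uM) D_y -[b * _ * _ * D u]mulrA => H.
apply: (etrans _ (etrans H _)); last first.
- congr (_ + (_ * _ + _ + _)).
    by apply: eq_bigr => i _; rewrite (LE _ (yfJ i yu) (bounded_J i uM)).
  by apply: eq_big_nat => j /andP[_ jk]; rewrite (LE _ (yfq j yu) (qM j jk)).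
- congr (_ * _ + _ + _ + (_ * _ + _ + _)).
  + by apply: eq_bigr => i _; rewrite D_y (DE (bounded_J i uM)).
  + by apply: eq_big_nat => j /andP[_ jk]; rewrite D_y (DE (qM j jk)).
  + by apply: eq_bigr => i _; rewrite (EE _ (yfJ i yu) (bounded_J i uM)).
  + by apply: eq_big_nat => j /andP[_ jk]; rewrite (EE _ (yfq j yu) (qM j jk)).
Qed.

Lemma commute_linear_in_y x : linear_in_y x ->
  D (L x) + E (L x) = L (D x) + L (E x).
Proof.
have [[DD DZ] [LD LZ] [ED EZ]] := And3 lD lL lE.
elim=> [k u|| u v _ IHu _ IHv|c u sc _ IH]; first exact: commute_y.
- by rewrite !(scalar_linear0 lD, scalar_linear0 lE, scalar_linear0 lL).
- by rewrite !(DD, LD, ED) addrACA IHu IHv addrACA.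
- by rewrite !(DZ, LZ, EZ) // -!mulrDr IH.
Qed.

Lemma D_T x : linear_in_y x -> D (T x) = T (D x) + T (E x) + T (L x).
Proof.
have [[DD DZ] [LD LZ] [ED EZ] [TD TZ]] := And4 lD lL lE lT.
elim=> [k u yu||u v _ IHu _ IHv|c u sc _ IH].
- have [M0 uM0] := boundP u; pose M := (k.+2 + M0)%N.
  have uM : bounded M u by apply: bounded_leq uM0; rewrite /M; lia.
  have kM : (k.+1 < M)%N by rewrite /M; lia.
  rewrite TE // (DE (bounded_q kM uM)) (LB_qS _ (y := fun n => q n.+1)) //.
  rewrite D_y TE; last exact: yfD.
  rewrite (DE uM) (LE k yu uM) (EE k yu uM).
  rewrite (scalar_linear_Lam _ _ _ lT) (scalar_linear_Ext _ _ _ lT).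
  rewrite -[RHS]addrA; congr (_ + (_ + _)).
  + rewrite /Ext TE //; congr (_ * _ + _ + _).
    * by apply: eq_bigr => i _; rewrite TE //; exact: yfJ.
    * by apply: eq_bigr => j _; rewrite TE ?mulrA //; exact: yfq.
    * by rewrite mulrA.
  + rewrite /Lam TE //; congr (_ * _ + _ + _).
    * by apply: eq_bigr => i _; rewrite TE //; exact: yfJ.
    * by apply: eq_bigr => j _; rewrite TE ?mulrA //; exact: yfq.
    * by rewrite mulrA.
- rewrite (scalar_linear0 lT) (scalar_linear0 lD) (scalar_linear0 lE).
  by rewrite (scalar_linear0 lL) (scalar_linear0 lT) !addr0.
- by rewrite !(DD, TD, LD, ED) IHu IHv; ring.
- by rewrite !(DZ, LZ, EZ, TZ) // IH; ring.
Qed.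

Lemma iter_commutator n c f : scalar c -> yfree f ->
  T (iter n.+1 L (c * y 0 * f))
  = D (T (iter n L (c * y 0 * f))) - T (iter n L (c * y 0 * D f)).
Proof.
move=> sc yf; rewrite -!mulrA.
have Lin_iter m : linear_in_y (iter m L (c * (y 0 * f))).
  by elim: m => [|m IH] /=; [exact/Lin_Z/Lin_y|exact: linear_in_y_L].
(* At k = 0 each term of [Ext] has weight zero: k itself, or k - j for the only index j = 0. *)
have E_y0 u : yfree u -> E (y 0 * u) = 0.
  have [M uM] := boundP u => yu; rewrite (EE _ yu uM) /Ext big_nat1.
  by rewrite !mulr0 !mul0r !addr0.
(* D + E moves through each [L]; on y_0 f only D remains, and it passes to f. *)
have iterDE m : D (iter m L (c * (y 0 * f))) + E (iter m L (c * (y 0 * f)))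
    = iter m L (c * (y 0 * D f)).
  elim: m => [|m IH] /=; last by rewrite commute_linear_in_y // -(proj1 lL) IH.
  by rewrite (proj2 lD) // (proj2 lE) // E_y0 // mulr0 addr0 D_y.
by rewrite D_T // -(proj1 lT) iterDE [X in _ = X - _]addrC addrK.
Qed.

End Operators.
End LaplaceBeltrami.

Section ScalarLinear.
Variables (R : comNzRingType) (scalar : R -> Prop).

Lemma scalar_linearD (X X' : R -> R) : scalar_linear scalar X ->
  scalar_linear scalar X' -> scalar_linear scalar (fun u => X u + X' u).
Proof.
move=> [XD XZ] [XD' XZ']; split=> [u v|c u sc]; first by rewrite XD XD' addrACA.
by rewrite XZ // XZ' // mulrDr.
Qed.

Lemma scalar_linear_mul (X : R -> R) d : scalar_linear scalar X ->
  scalar_linear scalar (fun u => d * X u).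
Proof.
by move=> [XD XZ]; split=> [u v|c u sc]; rewrite ?XD ?mulrDr // XZ // mulrCA.
Qed.

Lemma scalar_linear_comp (X X' : R -> R) : scalar_linear scalar X ->
  scalar_linear scalar X' -> scalar_linear scalar (fun u => X (X' u)).
Proof.
by move=> [XD XZ] [XD' XZ']; split=> [u v|c u sc]; rewrite ?XD' ?XD // XZ' // XZ.
Qed.

End ScalarLinear.

(** * Differential operators on polynomials *)

(* Conversion on [Pol] unfolds the whole monoid algebra, so equational
   reasoning with several candidate redexes is done in an abstract ring. *)
Lemma mulr_regroup4 (R : comNzRingType) (i j p d : R) :
  i * j * p * d = p * (i * (j * d)).
Proof. by ring. Qed.

Lemma mulr_regroup3 (R : comNzRingType) (i j p d : R) :
  i * j * p * d = j * p * (i * d).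
Proof. by ring. Qed.

Lemma mulr_regroup4_0 (R : comNzRingType) (i j p d : R) :
  i * (j * d) = 0 -> i * j * p * d = 0.
Proof. by rewrite mulr_regroup4 => ->; rewrite mulr0. Qed.

Lemma mulr_regroup3_0 (R : comNzRingType) (i j p d : R) :
  i * d = 0 -> i * j * p * d = 0.
Proof. by rewrite mulr_regroup3 => ->; rewrite mulr0. Qed.

Lemma mulr_regroup2_0 (R : comNzRingType) (i p d : R) :
  i * d = 0 -> i * p * d = 0.
Proof. by rewrite mulrAC => ->; rewrite mul0r. Qed.

Lemma mulr_regroup2 (R : comNzRingType) (i p p' d : R) :
  p = p' -> i * p * d = p' * (i * d).
Proof. by move=> ->; ring. Qed.

(** The added end terms contain q_0 = 0. *)
Lemma sum_mul_trim (R : nzRingType) (q : nat -> R) k : q 0 = 0 ->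
  \sum_(1 <= i < k) q i * q (k - i)%N = \sum_(0 <= i < k.+1) q i * q (k - i)%N.
Proof.
move=> q0; case: k => [|k]; first by rewrite big_geq // big_nat1 q0 mul0r.
by rewrite [RHS]big_nat_recr //= subnn q0 mulr0 addr0 [RHS]big_ltn //= q0 mul0r add0r.
Qed.

Lemma LB_congr (R : comNzRingType) (a b h x x' y y' z z' : R) :
  x = x' -> y = y' -> z = z' -> h * (a * x + y + b * z) = h * (a * x' + y' + b * z').
Proof. by move=> -> -> ->. Qed.

Lemma Lam_congr (R : comNzRingType) (a b n v u x x' y y' z : R) :
  x = x' -> y = y' -> z = n * v * u ->
  a * x + y + b * z = a * x' + y' + b * n * v * u.
Proof. by move=> -> -> ->; ring. Qed.

Lemma Ext_congr (R : comNzRingType) (a b h n m v u x x' y y' z : R) :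
  x = n * x' -> y = y' -> z = n * m * v * u ->
  a * x + y + b * h * z = a * n * x' + y' + b * h * n * m * v * u.
Proof. by move=> -> -> ->; ring. Qed.

Lemma mulr_regroup (R : comNzRingType) (k i v d : R) :
  k * i * v * d = k * (v * (i * d)).
Proof. by ring. Qed.

Lemma mulr_leibniz (R : comNzRingType) (c u v u' v' : R) :
  c * (u' * v + u * v') = c * u' * v + u * (c * v').
Proof. by ring. Qed.

Local Notation pderiv := Defs.deriv.
Local Notation ord1 := Defs.ord1.

(** [divcm] truncates exponents, so a quotient by an absent variable is meaningless; the coefficient
    is then zero and the monomials need not agree. *)
Lemma monalgUMn_eq (K : choiceType) (G : zmodType) (x : G) n (k l : K) :
  (n != 0%N -> k = l) -> << x *+ n *g k >> = << x *+ n *g l >>.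
Proof. by case: n => [_|n ->]; rewrite ?mulr0n ?monalgU0. Qed.

Lemma PolUU (c d : Qb) (m n : cmonom var) :
  << c *g m >> * << d *g n >> = << c * d *g mmul m n >> :> Pol.
Proof. by rewrite malgM_def fgmulUU. Qed.

Lemma Pol_ind (P : Pol -> Prop) :
  (forall c m, P << c *g m >>) -> (forall f g, P f -> P g -> P (f + g)) ->
  forall g, P g.
Proof.
move=> hU hD g; rewrite (monalgE g); apply: (big_rec P) => [|m h _]; last exact: hD.
(* The empty sum is covered as a monomial with coefficient 0. *)
have <- : << (0 : Qb) *g (mone : cmonom var) >> = 0 :> Pol by apply: monalgU0.
exact: hU.
Qed.

(** As the additive extension of its values on monomials, the derivative inherits additivity from
    [mmap]. *)
Lemma pderiv_mmap v g : pderiv v g =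
  mmap (@malgC (cmonom var) Qb)
       (fun m => << (m v)%:R *g divcm m (@ucm var v) >>) g.
Proof.
rewrite /pderiv mmapE; apply: eq_bigr => m _.
by rewrite PolUU mul1m mulr_natr.
Qed.

Fact pderiv_is_additive v : {morph pderiv v : f g / f - g}.
Proof. by move=> f g; rewrite !pderiv_mmap raddfB. Qed.

HB.instance Definition _ v := GRing.isZmodMorphism.Build Pol Pol (pderiv v)
  (pderiv_is_additive v).

Lemma pderiv0 v : pderiv v 0 = 0.
Proof. exact: raddf0. Qed.

Lemma pderivD v f g : pderiv v (f + g) = pderiv v f + pderiv v g.
Proof. exact: raddfD. Qed.

Lemma pderiv_sum v (I : Type) (r : seq I) (P : pred I) (F : I -> Pol) :
  pderiv v (\sum_(i <- r | P i) F i) = \sum_(i <- r | P i) pderiv v (F i).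
Proof. exact: raddf_sum. Qed.

Lemma pderivU v c (m : cmonom var) :
  pderiv v << c *g m >> = << c *+ m v *g divcm m (@ucm var v) >>.
Proof. by rewrite pderiv_mmap mmapU malgM_def fgmulUU mul1m mulr_natr. Qed.

Section Leibniz.
Variables (R : comNzRingType) (d : R -> R).
Hypothesis dD : forall f g, d (f + g) = d f + d g.

Definition leibniz f g := d (f * g) = d f * g + f * d g.

Lemma leibnizC f g : leibniz f g -> leibniz g f.
Proof. by rewrite /leibniz mulrC => ->; ring. Qed.

Lemma leibnizDl f1 f2 g : leibniz f1 g -> leibniz f2 g -> leibniz (f1 + f2) g.
Proof. by rewrite /leibniz mulrDl !dD => -> ->; ring. Qed.

End Leibniz.

(** Additivity in each factor reduces the rule to monomials, where exponents of [v] add up. *)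
Lemma pderivM v f g : pderiv v (f * g) = pderiv v f * g + f * pderiv v g.
Proof.
change (@leibniz Pol (pderiv v) f g).
elim/Pol_ind: f => [c m|f1 f2]; last exact/leibnizDl/pderivD.
apply: leibnizC; elim/Pol_ind: g => [d n|g1 g2]; last exact/leibnizDl/pderivD.
apply: leibnizC; rewrite /leibniz.
(* One term of the product rule; commutativity gives the other. For k_v > 0 the truncated
   subtraction commutes with adding exponents. *)
have half (a e : Qb) (k l : cmonom var) :
    pderiv v << a *g k >> * << e *g l >>
    = << a * e *+ k v *g divcm (mmul k l) (@ucm var v) >>.
  rewrite pderivU PolUU mulrnAl.
  apply: monalgUMn_eq => kv; apply/eqP/cmP => i; rewrite cmM !divcmE cmM ucmE.
  case: eqP => [<-|_]; last by rewrite !subn0.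
  by case: (k v) kv => // p _; rewrite addSn !subn1.
rewrite half [X in _ + X]mulrC half PolUU pderivU.
by rewrite cmM mulrnDr monalgUD (mulrC d) (mulmC n).
Qed.

Lemma comm_additiveD (R : nmodType) (d e : R -> R) f g :
  {morph d : x y / x + y} -> {morph e : x y / x + y} ->
  d (e f) = e (d f) -> d (e g) = e (d g) -> d (e (f + g)) = e (d (f + g)).
Proof. by move=> dD eD; rewrite dD !eD dD => -> ->. Qed.

Lemma pderivC v w g : pderiv v (pderiv w g) = pderiv w (pderiv v g).
Proof.
elim/Pol_ind: g => [c m|f g h1 h2]; last first.
  exact: comm_additiveD (pderivD v) (pderivD w) h1 h2.
(* The coefficient m_w (m_v - [w = v]) is symmetric in v and w. *)
have dd v' w' : pderiv v' (pderiv w' << c *g m >>) =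
    << c *+ (m w' * (m v' - (w' == v'))) *g
       divcm (divcm m (@ucm var w')) (@ucm var v') >>.
  by rewrite pderivU pderivU -mulrnA divcmE ucmE.
rewrite (dd v w) (dd w v) (eq_sym v).
have -> : (m w * (m v - (w == v)) = m v * (m w - (w == v)))%N.
  by case: eqP => [->//|_]; rewrite !subn0 mulnC.
by apply: monalgUMn_eq => _; apply/eqP/cmP => i; rewrite !divcmE subnAC.
Qed.

Lemma pderiv_cst v c : pderiv v (cst c) = 0.
Proof. by rewrite pderivU cm1 mulr0n monalgU0. Qed.

Lemma pderiv_var v w : pderiv v << @ucm var w >> = (v == w)%:R.
Proof.
rewrite pderivU ucmE eq_sym; case: eqP => [->|_]; last exact: monalgU0.
rewrite mulr1n; suff -> : divcm (ucm w) (ucm w) = mone by [].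
by apply/eqP/cmP => i; rewrite divcmE subnn cm1.
Qed.

Lemma pderiv_nat v n : pderiv v n%:R = 0.
Proof. by rewrite -mpolyC_nat pderiv_cst. Qed.

(** * Differential operators as sums over a common list of variables *)

Lemma pderiv_term0 v g (m : cmonom var) : v \notin finsupp m -> pderiv v (term g m) = 0.
Proof. by rewrite /term pderivU -cmE_eq0 => /eqP->; rewrite mulr0n monalgU0. Qed.

Lemma term_sum g : \sum_(m <- msupp g) term g m = g.
Proof. by rewrite {3}(monalgE g). Qed.

(** One list for all monomials of [g], so that sums over monomials and over variables can be
    exchanged. *)
Definition vars (g : Pol) : seq var :=
  undup (flatten [seq enum_fset (finsupp m) | m : cmonom var <- msupp g]).

Lemma mem_vars g (m : cmonom var) v : m \in msupp g -> v \in finsupp m -> v \in vars g.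
Proof.
move=> mg vm; rewrite mem_undup; apply/flattenP.
by exists (enum_fset (finsupp m)) => //; apply/mapP; exists m.
Qed.

Lemma pderiv_vars0 v g : v \notin vars g -> pderiv v g = 0.
Proof.
move=> vg; rewrite -(term_sum g) pderiv_sum big1_seq // => m mg.
apply: pderiv_term0; apply: contra vg; exact: mem_vars.
Qed.

Lemma sum_terms_vars (V : nmodType) g (F : var -> Pol -> V) :
  (forall (m : cmonom var) v, v \notin finsupp m -> F v (term g m) = 0) ->
  forall m : cmonom var, m \in msupp g ->
  \sum_(v <- finsupp m) F v (term g m) = \sum_(v <- vars g) F v (term g m).
Proof.
move=> F0 m mg; apply: big_seq_support; rewrite ?fset_uniq ?undup_uniq //.
- by move=> v vm; rewrite (mem_vars mg).
- by move=> v _; apply: F0.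
Qed.

(** Once every [finsupp m] is replaced by [vars g], the sums are exchanged and additivity of [F v]
    reassembles [g] from its terms. *)
Lemma sum_terms (F : var -> Pol -> Pol) g :
  (forall v, {morph F v : x y / x + y}) -> (forall v, F v 0 = 0) ->
  (forall (m : cmonom var) v, v \notin finsupp m -> F v (term g m) = 0) ->
  \sum_(m <- msupp g) \sum_(v <- finsupp m) F v (term g m)
  = \sum_(v <- vars g) F v g.
Proof.
move=> FD F0 Fsupp; rewrite (eq_big_seq _ (sum_terms_vars Fsupp)).
rewrite exchange_big; apply: eq_bigr => v _.
by rewrite -(big_morph (F v) (FD v) (F0 v)) term_sum.
Qed.

Lemma ord1E (c : var -> Pol) g (s : seq var) : uniq s ->
  (forall v, v \notin s -> c v * pderiv v g = 0) ->
  ord1 c g = \sum_(v <- s) c v * pderiv v g.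
Proof.
move=> us s0; rewrite /ord1 (sum_terms (F := fun v u => c v * pderiv v u)).
- apply: big_seq_support; rewrite ?undup_uniq // => v _; first exact: s0.
  by move=> /pderiv_vars0->; exact: mulr0.
- by move=> v f h; rewrite pderivD mulrDr.
- by move=> v; rewrite pderiv0; exact: mulr0.
- by move=> m v hv; rewrite pderiv_term0 //; exact: mulr0.
Qed.

Lemma ord2E (c : var -> var -> Pol) g (s : seq (var * var)) : uniq s ->
  (forall v w, (v, w) \notin s -> c v w * pderiv v (pderiv w g) = 0) ->
  ord2 c g = \sum_(p <- s) c p.1 p.2 * pderiv p.1 (pderiv p.2 g).
Proof.
move=> us s0; rewrite /ord2.
have d20 (m : cmonom var) v w : v \notin finsupp m ->
    c v w * pderiv v (pderiv w (term g m)) = 0.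
  by move=> hv; rewrite pderivC (pderiv_term0 _ hv) pderiv0; exact: mulr0.
(* Only the inner list is enlarged here; [sum_terms] then treats the inner sum as one additive
   operator. *)
transitivity (\sum_(m <- msupp g) \sum_(v <- finsupp m)
    \sum_(w <- vars g) c v w * pderiv v (pderiv w (term g m))).
  apply: eq_big_seq => m mg; apply: eq_bigr => v _.
  apply: (sum_terms_vars (F := fun w u => c v w * pderiv v (pderiv w u))) => //.
  by move=> n w hw; rewrite (pderiv_term0 _ hw) pderiv0; exact: mulr0.
rewrite (sum_terms (F := fun v u => \sum_(w <- vars g) c v w * pderiv v (pderiv w u))).
- rewrite -(big_allpairs (F := fun p => c p.1 p.2 * pderiv p.1 (pderiv p.2 g))).
  apply: big_seq_support => //.
  + by apply: allpairs_uniq; rewrite ?undup_uniq // => -[? ?] [? ?].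
  + by move=> -[v w] _; apply: s0.
  + move=> -[v w] _ /=; case: (boolP (w \in vars g)) => [wg|/pderiv_vars0->].
      case: (boolP (v \in vars g)) => [vg|/pderiv_vars0 dv].
        by rewrite (allpairs_f (fun x y => (x, y)) vg wg).
      by move=> _; rewrite pderivC dv pderiv0; exact: mulr0.
    by move=> _; rewrite pderiv0; exact: mulr0.
- move=> v f h; rewrite -big_split; apply: eq_bigr => w _.
  by rewrite (pderivD w) (pderivD v) mulrDr.
- by move=> v; apply: big1 => w _; rewrite (pderiv0 w) pderiv0; exact: mulr0.
- by move=> m v hv; apply: big1 => w _; exact: d20.
Qed.

Lemma pderivZ v c u : pderiv v (cst c * u) = cst c * pderiv v u.
Proof. by rewrite pderivM pderiv_cst mul0r add0r. Qed.

Lemma pderivZn v n u : pderiv v (n%:R * u) = n%:R * pderiv v u.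
Proof. by rewrite pderivM pderiv_nat mul0r add0r. Qed.

Definition is_cst (c : Pol) := exists x, c = cst x.

Lemma is_cst_nat n : is_cst n%:R.
Proof. by exists n%:R; rewrite /cst mpolyC_nat. Qed.

Lemma is_cstM c d : is_cst c -> is_cst d -> is_cst (c * d).
Proof. by move=> [x ->] [z ->]; exists (x * z); rewrite /cst mpolyCM. Qed.

Lemma ord1_vars (c : var -> Pol) u (s : seq var) : uniq s -> {subset vars u <= s} ->
  ord1 c u = \sum_(v <- s) c v * pderiv v u.
Proof.
move=> us su; apply: ord1E => // v vs; rewrite pderiv_vars0 ?mulr0 //.
by apply: contra vs; exact: su.
Qed.

Lemma ord2_vars (c : var -> var -> Pol) u (s : seq var) :
  uniq s -> {subset vars u <= s} ->
  ord2 c u = \sum_(p <- [seq (v, w) | v <- s, w <- s])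
    c p.1 p.2 * pderiv p.1 (pderiv p.2 u).
Proof.
move=> us su; apply: ord2E.
  by apply: allpairs_uniq => // -[? ?] [? ?].
move=> v w vs; have [wu|wu] := boolP (w \in vars u); last first.
  by rewrite (pderiv_vars0 wu) pderiv0 mulr0.
have [vu|vu] := boolP (v \in vars u); last first.
  by rewrite pderivC (pderiv_vars0 vu) pderiv0 mulr0.
by rewrite (allpairs_f (fun x y => (x, y)) (su _ vu) (su _ wu)) in vs.
Qed.

(** Cancellation can make the variables of a sum differ from those of its summands; a common list
    lets linearity be checked term by term. *)
Lemma vars_cover (u v w : Pol) : exists s : seq var,
  [/\ uniq s, {subset vars u <= s}, {subset vars v <= s} & {subset vars w <= s}].
Proof.
exists (undup (vars u ++ vars v ++ vars w)); split; first exact: undup_uniq.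
all: by move=> x xu; rewrite mem_undup !mem_cat xu ?orbT.
Qed.

Lemma ord1_linear (c : var -> Pol) : scalar_linear is_cst (ord1 c).
Proof.
split=> [u v|d u [x ->]].
  have [s [us su sv suv]] := vars_cover u v (u + v).
  rewrite (ord1_vars c us suv) (ord1_vars c us su) (ord1_vars c us sv).
  by rewrite -big_split; apply: eq_bigr => w _; rewrite pderivD mulrDr.
have [s [us su sxu _]] := vars_cover u (cst x * u) u.
rewrite (ord1_vars c us sxu) (ord1_vars c us su).
by rewrite big_distrr; apply: eq_bigr => w _; rewrite pderivZ mulrCA.
Qed.

Lemma ord2_linear (c : var -> var -> Pol) : scalar_linear is_cst (ord2 c).
Proof.
split=> [u v|d u [x ->]].
  have [s [us su sv suv]] := vars_cover u v (u + v).
  rewrite (ord2_vars c us suv) (ord2_vars c us su) (ord2_vars c us sv).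
  by rewrite -big_split; apply: eq_bigr => w _; rewrite (pderivD w.2) pderivD mulrDr.
have [s [us su sxu _]] := vars_cover u (cst x * u) u.
rewrite (ord2_vars c us sxu) (ord2_vars c us su).
by rewrite big_distrr; apply: eq_bigr => w _; rewrite (pderivZ w.2) pderivZ mulrCA.
Qed.

(** * Euler derivations, power sums and y-free polynomials *)

Definition euler i (u : Pol) : Pol := i%:R * pderiv (inl i) u.

(** [pv 0] is a variable like any other; sending index 0 to 0 lets sums start at 0. *)
Definition power_sum i : Pol := if i is 0 then 0 else pv i.

Lemma power_sumE i : (0 < i)%N -> power_sum i = pv i.
Proof. by move=> i0; rewrite -(prednK i0). Qed.

(** Stated by derivatives, this passes to products by Leibniz and to [euler i u] because partial
    derivatives commute. *)
Definition yfree (u : Pol) := forall k, pderiv (inr k) u = 0.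

Lemma eulerD i u v : euler i (u + v) = euler i u + euler i v.
Proof. by rewrite /euler pderivD mulrDr. Qed.

Lemma eulerM i u v : euler i (u * v) = euler i u * v + u * euler i v.
Proof. by rewrite /euler pderivM; apply: mulr_leibniz. Qed.

Lemma eulerE i j u :
  euler i (euler j u) = i%:R * (j%:R * pderiv (inl i) (pderiv (inl j) u)).
Proof. by rewrite /euler pderivZn. Qed.

Lemma eulerC i j u : euler i (euler j u) = euler j (euler i u).
Proof. by rewrite (eulerE i) (eulerE j) pderivC; apply: mulrCA. Qed.

Lemma euler_power_sum i j : euler i (power_sum j) = (i * (i == j))%:R.
Proof.
case: j => [|j]; first rewrite /euler pderiv0 mulr0.
  by case: i => [|i]; rewrite ?mul0n ?muln0.
by rewrite /euler pderiv_var natrM.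
Qed.

Lemma euler_cst i c : euler i (cst c) = 0.
Proof. by rewrite /euler pderiv_cst mulr0. Qed.

Lemma euler_yv i k : euler i (yv k) = 0.
Proof. by rewrite /euler pderiv_var mulr0. Qed.

Lemma cst_half : cst 2^-1 * 2 = 1.
Proof.
have <- : cst 2 = 2 by exact: mpolyC_nat.
have <- : cst (2^-1 * 2) = cst 2^-1 * cst 2 by exact: mpolyCM.
rewrite mulVf; first exact: mpolyC1E.
rewrite -(rmorph_nat (@tofrac {poly rat})) tofrac_eq0 -polyC_natr polyC_eq0.
by rewrite Num.Theory.pnatr_eq0.
Qed.

Lemma yfree_euler i u : yfree u -> yfree (euler i u).
Proof. by move=> yu k; rewrite /euler pderivZn pderivC yu pderiv0 mulr0. Qed.

Lemma yfree_power_sum j u : yfree u -> yfree (power_sum j * u).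
Proof.
move=> yu k; rewrite pderivM yu mulr0 addr0.
by case: j => [|j]; rewrite ?pderiv0 ?mul0r // pderiv_var mul0r.
Qed.

(** * Values of first- and second-order operators as sums over indices *)

Lemma pderiv_yv l k u : yfree u ->
  pderiv (inr l) (yv k * u) = (l == k)%:R * u.
Proof. by move=> yu; rewrite pderivM yu mulr0 addr0 pderiv_var. Qed.

Lemma ord1_yv (c : var -> Pol) k u : (forall i, c (inl i) = 0) -> yfree u ->
  ord1 c (yv k * u) = c (inr k) * u.
Proof.
move=> c0 yu; rewrite (ord1E (s := [:: inr k])) //.
  by rewrite big_seq1 (pderiv_yv _ _ yu) eqxx mul1r.
case=> [i|l] hl; first by rewrite c0 mul0r.
have lk : (l == k) = false by apply: contraNF hl => /eqP->; rewrite inE.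
by rewrite (pderiv_yv _ _ yu) lk mul0r mulr0.
Qed.

Lemma ord1_p (c : var -> Pol) M u : (forall k, c (inr k) = 0) ->
  (forall i, (M <= i)%N -> c (inl i) * pderiv (inl i) u = 0) ->
  ord1 c u = \sum_(0 <= i < M) c (inl i) * pderiv (inl i) u.
Proof.
move=> c0 cM; rewrite (ord1E (s := map inl (index_iota 0 M))).
- by rewrite big_map.
- by rewrite map_inj_uniq ?iota_uniq // => i j [].
case=> [i|k]; last by rewrite c0 mul0r.
rewrite mem_map => [|? ? []//]; rewrite mem_index_iota -leqNgt; exact: cM.
Qed.

Lemma ord2_yv (c : var -> var -> Pol) M k u :
  (forall v j, c v (inl j) = 0) -> (forall l w, c (inr l) w = 0) -> yfree u ->
  (forall i, (M <= i)%N -> c (inl i) (inr k) * pderiv (inl i) u = 0) ->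
  ord2 c (yv k * u) = \sum_(0 <= i < M) c (inl i) (inr k) * pderiv (inl i) u.
Proof.
move=> cp cy yu cM.
rewrite (ord2E (s := [seq (inl i, inr k) | i <- index_iota 0 M])).
- rewrite big_map; apply: eq_bigr => i _ /=.
  by rewrite (pderiv_yv _ _ yu) eqxx mul1r.
- by rewrite map_inj_uniq ?iota_uniq // => i j [].
case=> [i|l] [j|l'] hs; rewrite ?cp ?cy ?mul0r //.
rewrite (pderiv_yv _ _ yu); have [El|ne] := eqVneq l' k; last first.
  by rewrite mul0r pderiv0 mulr0.
rewrite mul1r El; apply: cM; rewrite leqNgt; apply: contra hs => iM.
by rewrite El; apply/mapP; exists i; rewrite ?mem_index_iota.
Qed.

Lemma ord2_p (c : var -> var -> Pol) M u :
  (forall v l, c v (inr l) = 0) -> (forall l w, c (inr l) w = 0) ->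
  (forall i j, (M <= i)%N || (M <= j)%N ->
     c (inl i) (inl j) * pderiv (inl i) (pderiv (inl j) u) = 0) ->
  ord2 c u = \sum_(0 <= i < M) \sum_(0 <= j < M)
    c (inl i) (inl j) * pderiv (inl i) (pderiv (inl j) u).
Proof.
move=> cr cl cM.
rewrite (ord2E (s := [seq (inl i, inl j) | i <- index_iota 0 M, j <- index_iota 0 M])).
- by rewrite big_allpairs_dep.
- by rewrite allpairs_uniq ?iota_uniq // => -[? ?] [? ?] _ _ [-> ->].
case=> [i|l] w; last by rewrite cl mul0r.
case: w => [j|l] hs; last by rewrite cr mul0r.
apply: (cM i j); rewrite (leqNgt M i) (leqNgt M j) -negb_and.
apply: contra hs => /andP[iM jM].
by apply: allpairs_f; rewrite mem_index_iota.
Qed.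

(** * The operators of the theorem *)

Local Notation alpha := (cst (1 + bb)).
Local Notation beta := (cst bb).
Local Notation half := (cst 2^-1).

(** The auxiliary E as a differential operator on all of [Pol], so that its linearity comes from
    [ord1] and [ord2]. *)
Definition Exty (u : Pol) : Pol :=
  alpha * ord2 (fun v w => match v, w with
                | inl i, inr k => (k * i)%:R * yv (k + i)
                | _, _ => 0 end) u
  + ord1 (fun v => match v with
                   | inr k => \sum_(0 <= j < k.+1) (k - j)%:R * yv (k - j) * power_sum j
                   | inl _ => 0 end) u
  + beta * half * ord1 (fun v => match v with
                   | inr k => k%:R * (k%:R - 1) * yv k
                   | inl _ => 0 end) u.

Lemma DalphaE M u : bounded euler M u ->
  Dalpha u = LB euler power_sum alpha beta half M u.
Proof.
move=> uM; rewrite /Dalpha /LB; apply: LB_congr.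
- rewrite (ord2_p (M := M)); [|by case|by []|].
    apply: eq_bigr => i _; apply: eq_bigr => j _; rewrite eulerE.
    (* The guards in [Dalpha] agree with the vanishing of [euler 0]. *)
    case: i => [|i]; first by rewrite /= !mul0r mulr0.
    case: j => [|j]; first by rewrite /= !mul0r !mulr0.
    by rewrite /= natrM addSn /=; apply: mulr_regroup4.
  move=> i j ij; have E : euler i (euler j u) = 0.
    by case/orP: ij => [/uM Ei|/uM ->]; [rewrite eulerC Ei|]; rewrite /euler pderiv0 mulr0.
  case: ifP => _; last exact: mul0r.
  by move: E; rewrite eulerE natrM; apply: mulr_regroup4_0.
- rewrite (ord1_p (M := M)); [|by []|].
    apply: eq_bigr => k _; rewrite -big_distrr /= /euler.
    apply: mulr_regroup2.
    apply: etrans (sum_mul_trim k (q := power_sum) erefl).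
    apply: eq_big_nat => i /andP[i0 ik].
    by rewrite (power_sumE i0) power_sumE ?subn_gt0.
  move=> i Mi; rewrite -big_distrr /=; exact/mulr_regroup2_0/(uM _ Mi).
- rewrite (ord1_p (M := M)); [|by []|].
    apply: eq_bigr => i _; rewrite /euler.
    (* At i = 0 the factors i.-1 = 0 and i - 1 = -1 differ, but both sides vanish. *)
    case: i => [|i]; first by rewrite /= !mul0r mulr0.
    rewrite natrM -natr1 addrK; exact: mulr_regroup3.
  move=> i Mi; rewrite natrM; exact/mulr_regroup3_0/(uM _ Mi).
Qed.

Lemma LambdaYE M k u : yfree u -> bounded euler M u ->
  LambdaY (yv k * u) = Lam euler power_sum alpha beta yv M k u.
Proof.
move=> yu uM; rewrite /LambdaY /Lam; apply: Lam_congr.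
- rewrite (ord2_yv (M := M)); [|by case|by []|by []|].
    apply: eq_bigr => i _; rewrite /= (addnC k).
    case: i => [|i]; last exact: mulr_regroup2.
    by rewrite /euler !mul0r mulr0.
  move=> i Mi; case: ifP => _; last exact: mul0r.
  exact/mulr_regroup2_0/(uM _ Mi).
- rewrite (ord1_yv _ (fun i => erefl) yu) -big_distrl /=.
  apply: (congr1 ( *%R^~ u)).
  (* The index of [Lam] is j = k + 1 - i; its extra value j = 0 contributes [power_sum 0], which is
     0. *)
  rewrite [RHS]big_ltn // [X in _ = X + _]mulr0 add0r [RHS]big_nat_rev /=.
  apply: eq_big_nat => i /andP[i0 ik].
  have -> : (1 + k.+1 - i.+1 = (k - i).+1)%N by lia.
  by have -> : (k - (k - i).+1 = i.-1)%N by lia.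
- by rewrite (ord1_yv _ (fun i => erefl) yu).
Qed.

Lemma ExtyE M k u : yfree u -> bounded euler M u ->
  Exty (yv k * u) = Ext euler power_sum alpha beta half yv M k u.
Proof.
move=> yu uM; rewrite /Exty /Ext; apply: Ext_congr.
- rewrite (ord2_yv (M := M)); [|by case|by []|by []|].
    rewrite [RHS]big_distrr; apply: eq_bigr => i _; rewrite natrM; exact: mulr_regroup.
  move=> i Mi; rewrite mulnC natrM; exact/mulr_regroup3_0/(uM _ Mi).
- by rewrite (ord1_yv _ (fun i => erefl) yu); exact: big_distrl.
- by rewrite (ord1_yv _ (fun i => erefl) yu).
Qed.

Lemma ThetaY_Yplus k u : yfree u ->
  ThetaY (Yplus (yv k * u)) = power_sum k.+1 * u.
Proof.
move=> yu; rewrite /ThetaY /Yplus (ord1_yv _ (fun i => erefl) yu).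
by rewrite (ord1_yv _ (fun i => erefl) yu).
Qed.

Lemma ThetaY_Yplus_linear : scalar_linear is_cst (fun u => ThetaY (Yplus u)).
Proof. exact: scalar_linear_comp (ord1_linear _) (ord1_linear _). Qed.

Lemma LambdaY_linear : scalar_linear is_cst LambdaY.
Proof.
apply: scalar_linearD; last exact/scalar_linear_mul/ord1_linear.
exact: scalar_linearD (scalar_linear_mul _ (ord2_linear _)) (ord1_linear _).
Qed.

Lemma Exty_linear : scalar_linear is_cst Exty.
Proof.
apply: scalar_linearD; last exact/scalar_linear_mul/ord1_linear.
exact: scalar_linearD (scalar_linear_mul _ (ord2_linear _)) (ord1_linear _).
Qed.

Lemma Dalpha_linear : scalar_linear is_cst Dalpha.
Proof.
apply: scalar_linear_mul.
apply: scalar_linearD; last exact/scalar_linear_mul/ord1_linear.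
exact: scalar_linearD (scalar_linear_mul _ (ord2_linear _)) (ord1_linear _).
Qed.

Lemma bounded_exists u : exists M, bounded euler M u.
Proof.
(* One more than the largest index of a p occurring in [u]. *)
exists (\max_(v <- vars u) (if v is inl i then i.+1 else 0%N)) => i Mi.
rewrite /euler pderiv_vars0 ?mulr0 //; apply: contraL Mi => iu; rewrite -ltnNge.
exact: (leq_bigmax_seq (P := predT)
  (F := fun v : var => if v is inl i then i.+1 else 0%N) (inl i) iu isT).
Qed.

Lemma yfreeD u v : yfree u -> yfree v -> yfree (u + v).
Proof. by move=> yu yv k; rewrite pderivD yu yv addr0. Qed.

Lemma yfreeM u v : yfree u -> yfree v -> yfree (u * v).
Proof. by move=> yu yv k; rewrite pderivM yu yv mul0r mulr0 addr0. Qed.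

Lemma yfree_cst c : yfree (cst c).
Proof. by move=> k; exact: pderiv_cst. Qed.

Lemma yfree_sum (r : seq nat) (F : nat -> Pol) :
  (forall i, yfree (F i)) -> yfree (\sum_(i <- r) F i).
Proof. by move=> yF k; rewrite pderiv_sum big1 // => i _; exact: yF. Qed.

Lemma yfree_p j : yfree (power_sum j).
Proof. by case: j => [|j] k; [exact: pderiv0|exact: pderiv_var]. Qed.

(** In the form [LB], D_alpha u is built from constants, power sums and Euler derivatives of [u]. *)
Lemma yfree_Dalpha u : yfree u -> yfree (Dalpha u).
Proof.
move=> yu; have [M uM] := bounded_exists u; rewrite (DalphaE uM) /LB.
have yn n : yfree (n%:R - 1).
  have -> : n%:R - 1 = cst (n%:R - 1).
    rewrite /cst monalgUB; apply: (f_equal2 (fun x y => x - y));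
      by rewrite ?mpolyC_nat ?mpolyC1E.
  exact: yfree_cst.
apply: yfreeM; first exact: yfree_cst.
apply: yfreeD; first apply: yfreeD.
- apply: yfreeM; first exact: yfree_cst.
  apply: yfree_sum => i; apply: yfree_sum => j; apply: yfreeM; first exact: yfree_p.
  exact/yfree_euler/yfree_euler.
- apply: yfree_sum => i; apply: yfreeM; last exact: yfree_euler.
  by apply: yfree_sum => j; apply: yfreeM; exact: yfree_p.
- apply: yfreeM; first exact: yfree_cst.
  apply: yfree_sum => i; apply: yfreeM; last exact: yfree_euler.
  by apply: yfreeM; [exact: yn|exact: yfree_p].
Qed.

Lemma yfree_inP f : inP f -> yfree f.
Proof.
move=> fP k; rewrite -(term_sum f) pderiv_sum big1_seq // => m mf.
apply: pderiv_term0; apply/negP => /(fP m mf)[i _]; discriminate.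
Qed.

Theorem theorem4p9 :
  (forall f : Pol, inP f -> Aop 1 f = cst (1 + bb)^-1 * pv 1 * f) /\
  (forall (j : nat) (f : Pol), (1 <= j)%N -> inP f ->
     Aop j.+1 f = Dalpha (Aop j f) - Aop j (Dalpha f)).
Proof.
split=> [f /yfree_inP yf|[|n] f // _ /yfree_inP yf].
  have -> : Aop 1 f = ThetaY (Yplus (cst (1 + bb)^-1 * (yv 0 * f))).
    by rewrite mulrA.
  rewrite (proj2 ThetaY_Yplus_linear); last by exists (1 + bb)^-1.
  by rewrite (ThetaY_Yplus _ yf); exact: mulrA.
(* Here c = 1/(1 + b), and A_{n+2} carries the power n + 1 of Lambda_Y. What remains is that [euler]
   kills constants, that these are scalars, and that [f] is y-free. *)
apply: (@iter_commutator Pol euler power_sum alpha beta half eulerD eulerM eulerC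
  euler_power_sum _ _ _ cst_half yv Dalpha LambdaY Exty (fun u => ThetaY (Yplus u))
  is_cst yfree euler_yv _ _ _ is_cst_nat is_cstM yfree_euler yfree_power_sum
  yfree_Dalpha bounded_exists Dalpha_linear LambdaY_linear Exty_linear
  ThetaY_Yplus_linear DalphaE LambdaYE ExtyE ThetaY_Yplus).
all: try exact: yf; try (by move=> i; exact: euler_cst).
all: by eexists.
Qed.
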